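(* Let $X$ be a complete CAT(0) space, and let $\alpha$ and $\beta$ be distinct geodesic rays based at $x_0\in X$. Assume $\alpha$ is contracting. Then (1) the projection of $\beta$ on $\alpha$ is bounded; (2) there exists a bi-infinite geodesic $\gamma:\mathbb{R}\to X$ such that $\gamma(\infty)=\alpha(\infty)$ and $\gamma(-\infty)=\beta(\infty)$.
   Context: For a geodesic $\alpha$, $\pi_\alpha$ denotes nearest point projection onto $\alpha$, and the projection of $\beta$ on $\alpha$ is $\pi_\alpha(\beta)$. $\alpha$ is contracting if there is $D$ such that for all $x,y\in X$, $d(x,y)<d(x,\pi_\alpha(x))$ implies $d(\pi_\alpha(x),\pi_\alpha(y))<D$. For a geodesic ray $\alpha$, $\alpha(\infty)$ denotes its class in the visual boundary $\partial X$ (rays are equivalent if they stay at bounded distance). For a bi-infinite geodesic $\gamma$, $\gamma(\infty)$ and $\gamma(-\infty)$ are the classes of the rays $t\mapsto\gamma(t)$ and $t\mapsto\gamma(-t)$, $t\ge0$. *)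

(* Defs.v *)
From HB Require Import structures.
From mathcomp Require Import all_boot all_order all_algebra.
From mathcomp Require Import all_classical all_reals all_analysis.

Set Implicit Arguments.
Unset Strict Implicit.
Unset Printing Implicit Defensive.

Import Order.TTheory GRing.Theory Num.Theory.
Import numFieldNormedType.Exports.
Local Open Scope classical_set_scope.
Local Open Scope ring_scope.

Section Geodesics.
Variables (R : realType) (X : metricType R).

(* Only the restriction of [c : R -> X] to [I] matters: the values of [c]
   outside [I] are junk. *)
Definition geodesic_on (I : set R) (c : R -> X) : Prop :=
  forall s t, I s -> I t -> mdist (c s) (c t) = `|s - t|.

Definition geodesic_segment (x y : X) (c : R -> X) : Prop :=
  [/\ c 0 = x, c (mdist x y) = y & geodesic_on `[0, mdist x y] c].

Definition geodesic_ray (c : R -> X) : Prop := geodesic_on `[0, +oo[ c.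

Definition geodesic_line (c : R -> X) : Prop := geodesic_on setT c.

Definition ray_image (c : R -> X) : set X := c @` `[0, +oo[.

Definition geodesic_space : Prop :=
  forall x y : X, exists c, geodesic_segment x y c.

Definition complete_space : Prop :=
  forall u : nat -> X, cauchy (u @ \oo) -> exists l : X, u @ \oo --> l.

Definition bounded_subset (A : set X) : Prop :=
  exists M : R, forall p q, A p -> A q -> mdist p q <= M.

End Geodesics.

Section Cat0.
Variables (R : realType) (X : metricType R).

(* The library norm on ['rV[R]_2] is the sup norm, hence this definition. *)
Definition euclid_dist (u v : 'rV[R]_2) : R :=
  Num.sqrt (\sum_i (u 0 i - v 0 i) ^+ 2).

(* The point at distance [s] from [u] on the segment from [u] to [v], when
   [0 <= s <= euclid_dist u v]; it is [u] if [u = v]. *)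
Definition euclid_point (u v : 'rV[R]_2) (s : R) : 'rV[R]_2 :=
  u + (s / euclid_dist u v) *: (v - u).

(* A geodesic triangle has vertices [v i] and sides [c i] from [v i] to
   [v (i + 1)], where [i + 1] is taken modulo 3 in ['I_3]. *)
Definition geodesic_triangle (v : 'I_3 -> X) (c : 'I_3 -> R -> X) : Prop :=
  forall i, geodesic_segment (v i) (v (i + 1)) (c i).

Definition comparison_triangle (v : 'I_3 -> X) (w : 'I_3 -> 'rV[R]_2) : Prop :=
  forall i j, euclid_dist (w i) (w j) = mdist (v i) (v j).

Definition cat0_inequality (v : 'I_3 -> X) (c : 'I_3 -> R -> X)
    (w : 'I_3 -> 'rV[R]_2) : Prop :=
  forall i j (s t : R),
    0 <= s <= mdist (v i) (v (i + 1)) ->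
    0 <= t <= mdist (v j) (v (j + 1)) ->
    mdist (c i s) (c j t) <=
      euclid_dist (euclid_point (w i) (w (i + 1)) s)
                  (euclid_point (w j) (w (j + 1)) t).

Definition cat0_space : Prop :=
  geodesic_space X /\
  forall v c w, geodesic_triangle v c -> comparison_triangle v w ->
    cat0_inequality v c w.

End Cat0.

Section Projection.
Variables (R : realType) (X : metricType R).

Definition nearest_points (A : set X) (x : X) : set X :=
  [set p | A p /\ forall q, A q -> mdist x p <= mdist x q].

(* In a complete CAT(0) space, a nonempty closed convex subset [A] (such as the
   image of a geodesic ray) has exactly one point nearest to [x]; the default
   value [x] is used only when there is none. *)
Definition nearest_proj (A : set X) (x : X) : X := xget x (nearest_points A x).

Definition contracting (A : set X) : Prop :=
  exists D : R, forall x y : X,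
    mdist x y < mdist x (nearest_proj A x) ->
    mdist (nearest_proj A x) (nearest_proj A y) < D.

End Projection.

Section Boundary.
Variables (R : realType) (X : metricType R).

Definition asymptotic (a b : R -> X) : Prop :=
  exists K : R, forall t, 0 <= t -> mdist (a t) (b t) <= K.

(* A point of the visual boundary is an equivalence class of geodesic rays. *)
Definition boundary_point (a : R -> X) : set (R -> X) :=
  [set b | geodesic_ray b /\ asymptotic a b].

End Boundary.

(* Main.v *)
(* Write f for the distance to alpha and p for the arc length parameter of the
   projection to alpha.  Contraction upgrades the triangle inequality to
   d(x, alpha q) >= f(x) + |q - p(x)| - D, and it forces the geodesic from x to
   alpha q to come within 1 + 2D of alpha near the projection of x.

   (1) Applied with x = beta t and q = 0, this gives a point beta s close to
   alpha s with s >= p(beta t) - D; convexity of the metric bounds such s, since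
   distinct rays with the same origin diverge at least linearly.

   (2) Applied with x = beta n and q = n, it shows that the segments from beta n
   to alpha n meet a fixed ball and have length at least 2n - C.  Hence
   d(x, alpha n) + d(x, beta n) - 2n, which decreases to a convex function of x
   (the sum of two Busemann functions), has a limit whose infimum is finite and
   is approached inside that ball; it is attained at some z because X is
   complete and CAT(0).  The two rays from z asymptotic to alpha and beta then form a
   geodesic line. *)
Require Import Defs.
From mathcomp Require Import all_boot all_order all_algebra.
From mathcomp Require Import all_classical all_reals all_analysis.
From mathcomp Require Import ring lra.
Import Order.TTheory GRing.Theory Num.Theory.
Import numFieldNormedType.Exports.
Local Open Scope classical_set_scope.
Local Open Scope ring_scope.

Set Implicit Arguments.
Unset Strict Implicit.
Unset Printing Implicit Defensive.

(** * Comparison triangles and Stewart's inequality *)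

Section EuclideanPlane.
Variable R : realType.

Definition vec2 (a b : R) : 'rV[R]_2 := \row_i (if i == 0 then a else b).

Lemma euclid_distE (u v : 'rV[R]_2) : euclid_dist u v =
  Num.sqrt ((u 0 0 - v 0 0) ^+ 2 + (u 0 1 - v 0 1) ^+ 2).
Proof.
rewrite /euclid_dist 2!big_ord_recl big_ord0 addr0.
by rewrite (_ : lift ord0 ord0 = 1)//; exact/val_inj.
Qed.

Lemma vec2_0 a b : vec2 a b 0 0 = a. Proof. by rewrite mxE. Qed.
Lemma vec2_1 a b : vec2 a b 0 1 = b. Proof. by rewrite mxE. Qed.

(** With [q] at the origin and [r] at [(l, 0)], the law of cosines gives the abscissa [u] of [p].
    The last clause is Stewart's theorem, an identity in the plane. *)
Lemma comparison_triangle_exists (a b l : R) : 0 <= a -> 0 <= b -> 0 < l ->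
  l <= a + b -> a <= l + b -> b <= a + l ->
  exists p q r : 'rV[R]_2,
    [/\ euclid_dist p q = a, euclid_dist p r = b, euclid_dist q r = l &
     forall t, l * euclid_dist p (euclid_point q r t) ^+ 2 =
       (l - t) * a ^+ 2 + t * b ^+ 2 - t * (l - t) * l].
Proof.
move=> a0 b0 l0 lab alb bal.
have ln0 : l != 0 by rewrite gt_eqF.
pose u := (a ^+ 2 + l ^+ 2 - b ^+ 2) / (2 * l).
have ul : 2 * (u * l) = a ^+ 2 + l ^+ 2 - b ^+ 2 by rewrite /u; field.
have h0 : 0 <= a ^+ 2 - u ^+ 2.
  have : 0 <= (2 * l) ^+ 2 * (a ^+ 2 - u ^+ 2).
    (* Heron's factorisation: each factor is nonnegative by a triangle inequality. *)
    have -> : (2 * l) ^+ 2 * (a ^+ 2 - u ^+ 2) =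
       ((a + l + b) * (a + l - b)) * ((b + a - l) * (b + l - a)).
      by rewrite /u; field.
    by apply: mulr_ge0; apply: mulr_ge0; lra.
  by rewrite pmulr_rge0// exprn_gt0//; lra.
have h2 := sqr_sqrtr h0; set h := Num.sqrt _ in h2.
have sq (x y : R) : 0 <= y -> x = y ^+ 2 -> Num.sqrt x = y.
  by move=> y0 ->; rewrite sqrtr_sqr ger0_norm.
have dqr : euclid_dist (vec2 0 0) (vec2 l 0) = l.
  by rewrite euclid_distE !(vec2_0, vec2_1); apply: sq; [exact: ltW|ring].
exists (vec2 u h), (vec2 0 0), (vec2 l 0); split => //.
- rewrite euclid_distE !(vec2_0, vec2_1); apply: sq => //; rewrite !subr0 h2.
  by ring.
- rewrite euclid_distE !(vec2_0, vec2_1); apply: sq => //.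
  rewrite subr0 h2.
  have -> : (u - l) ^+ 2 = u ^+ 2 - 2 * (u * l) + l ^+ 2 by ring.
  by rewrite ul; ring.
- move=> t; rewrite euclid_distE sqr_sqrtr; last by rewrite addr_ge0 ?sqr_ge0.
  rewrite /euclid_point dqr !mxE /=.
  rewrite !(subr0, addr0, add0r, mulr0) h2.
  have -> : b ^+ 2 = a ^+ 2 + l ^+ 2 - 2 * (u * l) by rewrite ul; ring.
  by field.
Qed.

End EuclideanPlane.

(* [mdist] takes its values in [R] seen as a [numDomainType]; this version keeps
   the order and the norm of [R : realType]. *)
Definition dist (R : realType) (X : metricType R) (x y : X) : R := mdist x y.

Section Distance.
Variables (R : realType) (X : metricType R).
Implicit Types x y z : X.

Lemma dist_ge0 x y : 0 <= dist x y. Proof. exact: mdist_ge0. Qed.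

Lemma distxx x : dist x x = 0. Proof. exact: mdistxx. Qed.

Lemma dist_eq0 x y : dist x y = 0 -> x = y. Proof. exact: mdist_positivity. Qed.

Lemma dist_sym x y : dist x y = dist y x. Proof. exact: metric_sym. Qed.

Lemma dist_triangle x y z : dist x z <= dist x y + dist y z.
Proof. exact: metric_triangle. Qed.

End Distance.

Section Cat0Comparison.
Variables (R : realType) (X : metricType R).
Local Notation d := (@dist R X).

(** Says that [m] lies on a geodesic from [x] to [y] without naming a parametrisation;
    [geodesic_through] recovers one. *)
Definition between (x m y : X) := d x m + d m y = d x y.

Lemma between_sym x m y : between x m y -> between y m x.
Proof.
by rewrite /between (dist_sym y m) (dist_sym m x) (dist_sym y x); lra.
Qed.

Lemma geodesic_segment_dist x y c : geodesic_segment x y c ->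
  [/\ c 0 = x, c (d x y) = y & forall s t : R, 0 <= s <= d x y ->
    0 <= t <= d x y -> d (c s) (c t) = `|s - t|].
Proof.
by move=> [c0 c1 cg]; split => // s t hs ht; apply: cg; rewrite /= in_itv.
Qed.

Lemma geodesic_segment_between x y c (t : R) : geodesic_segment x y c ->
  0 <= t <= d x y ->
  [/\ d x (c t) = t, d (c t) y = d x y - t & between x (c t) y].
Proof.
move=> /geodesic_segment_dist[c0 c1 cg] /andP[t0 t1]; have l0 := dist_ge0 x y.
have h1 : d x (c t) = t.
  rewrite -{1}c0 cg ?lexx ?t0 ?l0//.
  by rewrite sub0r normrN ger0_norm.
have h2 : d (c t) y = d x y - t.
  rewrite -{1}c1 cg ?lexx ?t0 ?l0//.
  by rewrite distrC ger0_norm// subr_ge0.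
by split => //; rewrite /between h1 h2; lra.
Qed.

Hypothesis X_cat0 : cat0_space X.

Lemma exists_between x y (t : R) : 0 <= t <= d x y ->
  exists m, [/\ d x m = t, d m y = d x y - t & between x m y].
Proof.
move=> ht; have [c hc] := X_cat0.1 x y.
by exists (c t); exact: geodesic_segment_between.
Qed.

(** Concatenate segments from [x] to [m] and from [m] to [y]. No piece is longer than its parameter
    interval, and since the total is [d x y] none can be shorter. *)
Lemma geodesic_through x m y : between x m y ->
  exists2 c, geodesic_segment x y c & c (d x m) = m.
Proof.
move=> bm.
have [c1 hc1] := X_cat0.1 x m; have [c2 hc2] := X_cat0.1 m y.
have [c10 c11 cg1] := geodesic_segment_dist hc1.
have [c20 c21 cg2] := geodesic_segment_dist hc2.
have a0 := dist_ge0 x m; have b0 := dist_ge0 m y.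
have bm' : d x m + d m y = d x y := bm.
pose c t := if t <= d x m then c1 t else c2 (t - d x m).
have cm : c (d x m) = m by rewrite /c lexx.
have c0 : c 0 = x by rewrite /c a0.
have cl : c (d x y) = y.
  rewrite /c; case: ifPn => [h|_].
    have my : m = y by apply: dist_eq0; move: bm h b0; rewrite /between; lra.
    by rewrite -my.
  by rewrite -bm (addrC (d x m)) addrK.
have cle s t : 0 <= s -> s <= t -> t <= d x y -> d (c s) (c t) = t - s.
  move=> s0 st tl.
  have up : d (c s) (c t) <= t - s.
    rewrite /c; case: (lerP s (d x m)) => hs; case: (lerP t (d x m)) => ht.
    - rewrite cg1; [|lra..].
      by rewrite distrC ger0_norm// subr_ge0.
    - have [_ e1 _] := geodesic_segment_between hc1 (t := s) ltac:(lra).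
      have [e2 _ _] := geodesic_segment_between hc2 (t := t - d x m) ltac:(lra).
      have := dist_triangle (c1 s) m (c2 (t - d x m)); lra.
    - lra.
    - rewrite cg2; [|lra..].
      by rewrite distrC ger0_norm; lra.
  have h1 : d x (c s) <= s.
    rewrite /c; case: (lerP s (d x m)) => hs.
      by have [-> _ _] := geodesic_segment_between hc1 (t := s) ltac:(lra).
    have [e2 _ _] := geodesic_segment_between hc2 (t := s - d x m) ltac:(lra).
    have := dist_triangle x m (c2 (s - d x m)); lra.
  have h2 : d (c t) y <= d x y - t.
    rewrite /c; case: (lerP t (d x m)) => hs.
      have [_ e1 _] := geodesic_segment_between hc1 (t := t) ltac:(lra).
      have := dist_triangle (c1 t) m y; lra.
    have [_ e2 _] := geodesic_segment_between hc2 (t := t - d x m) ltac:(lra).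
    lra.
  have := dist_triangle x (c s) y; have := dist_triangle (c s) (c t) y.
  lra.
exists c => //; split => // s t.
rewrite /= !in_itv/= => /andP[s0 sl] /andP[t0 tl].
change (d (c s) (c t) = `|s - t|).
case: (lerP s t) => st; first by rewrite cle// distrC ger0_norm// subr_ge0.
by rewrite dist_sym cle// ?ltW// gtr0_norm// subr_gt0.
Qed.

(** Comparing [p] and [m] with the plane turns Stewart's identity into an inequality. All later
    curvature arguments go through this form of the CAT(0) condition. *)
Lemma stewart p x m y : between x m y ->
  d x y * d p m ^+ 2 <=
    d m y * d p x ^+ 2 + d x m * d p y ^+ 2 - d x m * d m y * d x y.
Proof.
move=> bm; have a0 := dist_ge0 x m; have b0 := dist_ge0 m y.
move: (bm); rewrite {1}/between => bm'.
have [l0|l0] := eqVneq (d x y) 0.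
  have -> : d m y = 0 by lra.
  have -> : d x m = 0 by lra.
  by rewrite l0; lra.
have {}l0 : 0 < d x y by rewrite lt_neqAle eq_sym l0 dist_ge0.
have [c hc cm] := geodesic_through bm.
have [c1 hc1] := X_cat0.1 p x; have [c2 hc2] := X_cat0.1 y p.
have t1 := dist_triangle x p y; rewrite (dist_sym x p) in t1.
have t2 := dist_triangle p y x; rewrite (dist_sym y x) addrC in t2.
have t3 := dist_triangle p x y.
have [P [Q [S [PQ PS QS hS]]]] := comparison_triangle_exists (dist_ge0 p x)
  (dist_ge0 p y) l0 t1 t2 t3.
pose v : 'I_3 -> X := tnth [tuple p; x; y].
pose cc : 'I_3 -> R -> X := tnth [tuple c1; c; c2].
pose w : 'I_3 -> 'rV[R]_2 := tnth [tuple P; Q; S].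
have ed0 (U : 'rV[R]_2) : euclid_dist U U = 0.
  by rewrite euclid_distE !subrr expr0n/= addr0 sqrtr0.
have eds (U V : 'rV[R]_2) : euclid_dist U V = euclid_dist V U.
  by rewrite !euclid_distE; congr Num.sqrt; ring.
have hv : geodesic_triangle v cc.
  by case=> [[|[|[|//]]]] i; rewrite /geodesic_segment.
have hw : comparison_triangle v w.
  case=> [[|[|[|//]]]] i; case=> [[|[|[|//]]]] j; rewrite /v /w /tnth/=;
    rewrite ?ed0 ?mdistxx//; by rewrite 1?eds 1?metric_sym.
(* Parameter 0 on the side from [p] to [x] is [p]; parameter [d x m] on the side from [x] to [y] is
   [m]. *)
have := X_cat0.2 v cc w hv hw ord0 1 0 (d x m).
rewrite mdist_ge0 lexx => /(_ isT).
have -> : cc ord0 0 = p by case: hc1.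
have -> : cc 1 (d x m) = m by [].
have -> : v 1 = x by []. have -> : v (1 + 1) = y by [].
have -> : euclid_point (w ord0) (w (ord0 + 1)) 0 = P.
  by rewrite /euclid_point mul0r scale0r addr0.
have -> : w 1 = Q by []. have -> : w (1 + 1) = S by [].
rewrite a0/= => /(_ ltac:(rewrite -/(d x y); lra)) H.
have := hS (d x m); have -> : d x y - d x m = d m y by lra.
move=> <-; rewrite ler_pM2l// ler_pXn2r// ?nnegrE ?dist_ge0//.
exact: sqrtr_ge0.
Qed.

End Cat0Comparison.

(** * Convexity of the distance *)

Section Cat0Consequences.
Variables (R : realType) (X : metricType R).
Hypothesis X_cat0 : cat0_space X.
Local Notation d := (@dist R X).

(** The law of cosines with the comparison angle at [p] of the large triangle, cleared of
    denominators. Stewart is used twice, passing through [d x q2]. *)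
Lemma two_sided_comparison p x y q1 q2 : between p x q1 -> between p y q2 ->
  d p q1 * d p q2 * d x y ^+ 2 <=
  d p q1 * d p q2 * (d p x ^+ 2 + d p y ^+ 2) -
  d p x * d p y * (d p q1 ^+ 2 + d p q2 ^+ 2 - d q1 q2 ^+ 2).
Proof.
move=> b1 b2; have := stewart X_cat0 x b2; have := stewart X_cat0 q2 b1.
have -> : d x q1 = d p q1 - d p x by rewrite -b1; lra.
have -> : d y q2 = d p q2 - d p y by rewrite -b2; lra.
rewrite (dist_sym q2 x) (dist_sym q2 p) (dist_sym q2 q1) (dist_sym x p).
have := dist_ge0 p y; have := dist_ge0 p q1.
move: (d p q1) (d p q2) (d x y) (d p x) (d p y) (d q1 q2) (d x q2).
move=> a b z s t e w a0 t0 h1 h2.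
have := ler_wpM2l a0 h2; have := ler_wpM2l t0 h1; lra.
Qed.

(** For points at equal proportions the two-sided comparison collapses to the square of the
    claim. *)
Lemma thales p x y q1 q2 : between p x q1 -> between p y q2 ->
  d p x * d p q2 = d p y * d p q1 -> d p q1 * d x y <= d p x * d q1 q2.
Proof.
move=> b1 b2 prop.
have a0 := dist_ge0 p q1; have s0 := dist_ge0 p x.
have t0 := dist_ge0 p y; have bb0 := dist_ge0 p q2.
have [b0|bn0] := eqVneq (d p q2) 0.
  have y0 : d p y = 0 by move: b2 (dist_ge0 y q2); rewrite /between; lra.
  have yp := dist_eq0 y0; have qp := dist_eq0 b0.
  by rewrite -yp -qp (dist_sym x) (dist_sym q1); lra.
have {bn0 bb0}b0 : 0 < d p q2 by rewrite lt_neqAle eq_sym bn0.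
have H := two_sided_comparison b1 b2.
suff : (d p q1 * d x y) ^+ 2 <= (d p x * d q1 q2) ^+ 2.
  by rewrite ler_pXn2r// ?nnegrE ?mulr_ge0 ?dist_ge0.
rewrite -(ler_pM2l b0).
have := ler_wpM2l a0 H.
move: prop; move: (d p q1) (d p q2) (d x y) (d p x) (d p y) (d q1 q2).
move=> a b z s t e prop.
have -> : a * (a * b * (s ^+ 2 + t ^+ 2) - s * t * (a ^+ 2 + b ^+ 2 - e ^+ 2)) =
  (t * a) ^+ 2 * b + (s * a) ^+ 2 * b - s * (t * a) * (a ^+ 2 + b ^+ 2 - e ^+ 2)
  by ring.
rewrite -prop => h; apply: le_trans (le_trans h _).
  by rewrite le_eqVlt; apply/orP; left; apply/eqP; ring.
by rewrite le_eqVlt; apply/orP; left; apply/eqP; ring.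
Qed.

Lemma midpoint_CN x y : exists m, forall p,
  4 * d p m ^+ 2 <= 2 * d p x ^+ 2 + 2 * d p y ^+ 2 - d x y ^+ 2.
Proof.
have l0 := dist_ge0 x y.
have [m [xm my bm]] := @exists_between R X X_cat0 x y (d x y / 2) ltac:(lra).
exists m => p; have := stewart X_cat0 p bm; rewrite xm my.
move: l0; rewrite le_eqVlt => /orP[/eqP l0 _|l0].
  have xm0 : d x m = 0 by rewrite xm -l0; lra.
  have my0 : d m y = 0 by rewrite my -l0; lra.
  by rewrite -(dist_eq0 my0) -(dist_eq0 xm0) distxx; lra.
move=> h; rewrite -(ler_pM2l l0); move: h; lra.
Qed.

(** Follows from [d x y] being at least the difference of [d p x] and [d p y]. *)
Lemma CN_midpoint_le p x y m :
  4 * d p m ^+ 2 <= 2 * d p x ^+ 2 + 2 * d p y ^+ 2 - d x y ^+ 2 ->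
  2 * d p m <= d p x + d p y.
Proof.
have l0 := dist_ge0 x y; have a0 := dist_ge0 p x; have b0 := dist_ge0 p y.
have := dist_triangle x y p; have := dist_triangle y x p.
rewrite !(dist_sym _ p) (dist_sym y x) => t1 t2 H.
suff : (2 * d p m) ^+ 2 <= (d p x + d p y) ^+ 2.
  by rewrite ler_pXn2r// ?nnegrE ?mulr_ge0 ?addr_ge0 ?dist_ge0.
have : 0 <= (d x y - (d p x - d p y)) * (d x y + (d p x - d p y)).
  by apply: mulr_ge0; lra.
move: H; lra.
Qed.

End Cat0Consequences.

(** * Projection to a contracting ray *)

Section Rays.
Variables (R : realType) (X : metricType R).
Local Notation d := (@dist R X).
Variables (alpha : R -> X) (alpha_ray : geodesic_ray alpha).
Implicit Types (x y : X) (q s t u : R).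

Lemma ray_dist s t : 0 <= s -> 0 <= t -> d (alpha s) (alpha t) = `|s - t|.
Proof. by move=> s0 t0; apply: alpha_ray; rewrite /= in_itv/= andbT. Qed.

Lemma ray_dist_le s t : 0 <= s -> s <= t -> d (alpha s) (alpha t) = t - s.
Proof.
move=> s0 st; rewrite ray_dist// ?(le_trans s0)// distrC ger0_norm//.
by rewrite subr_ge0.
Qed.

Lemma ray_dist0 t : 0 <= t -> d (alpha 0) (alpha t) = t.
Proof. by move=> t0; rewrite ray_dist_le// subr0. Qed.

Lemma ray_between s t u : 0 <= s -> s <= t -> t <= u ->
  between (alpha s) (alpha t) (alpha u).
Proof.
by move=> s0 st tu; rewrite /between !ray_dist_le; lra.
Qed.

Let A := ray_image alpha.

Lemma ray_nearest x : exists p, nearest_points A x p.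
Proof.
pose g (t : R) := d x (alpha `|t|).
have g_lip s t : `|g t - g s| <= `|t - s|.
  apply: le_trans (ler_dist_dist t s).
  rewrite -(ray_dist (normr_ge0 t) (normr_ge0 s)) ler_norml /g.
  have := dist_triangle x (alpha `|t|) (alpha `|s|).
  have := dist_triangle x (alpha `|s|) (alpha `|t|).
  by rewrite (dist_sym (alpha `|s|)); lra.
have gc : continuous g.
  move=> t; apply/cvgrPdist_lt => e e0; near=> s.
  apply: le_lt_trans (g_lip s t) _.
  by near: s; have /cvgrPdist_lt := @cvg_id _ (nbhs t); exact.
have x00 := dist_ge0 x (alpha 0).
(* Beyond this parameter the ray is farther from [x] than [alpha 0] is, so a minimum on the compact
   interval is global. *)
have [c /[!in_itv]/= /andP[c0 _] hc] := @EVT_min R g 0 (2 * d x (alpha 0))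
  ltac:(lra) (continuous_subspaceT gc).
have gE t : 0 <= t -> g t = d x (alpha t) by move=> t0; rewrite /g ger0_norm.
exists (alpha c); split; first by exists c => //=; rewrite in_itv/= c0.
move=> _ [t /=/[!in_itv]/= /andP[t0 _] <-].
rewrite -/(d x (alpha c)) -/(d x (alpha t)) -!gE//.
case: (lerP t (2 * d x (alpha 0))) => ht.
  by apply: hc; rewrite in_itv/= t0.
have : g c <= g 0 by apply: hc; rewrite in_itv/= lexx; lra.
rewrite !gE//; have := dist_triangle (alpha 0) x (alpha t).
by rewrite ray_dist0// (dist_sym _ x); lra.
Unshelve. all: by end_near. Qed.

(** Distance to [alpha 0] is arc length along the ray, so this is the parameter of the
    projection. *)
Definition foot x := d (alpha 0) (nearest_proj A x).

Lemma foot_ge0 x : 0 <= foot x. Proof. exact: dist_ge0. Qed.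

Lemma nearest_projE x : nearest_proj A x = alpha (foot x).
Proof.
have [[t /=/[!in_itv]/= /andP[t0 _] e] _] := xgetPex x (ray_nearest x).
by rewrite /foot /nearest_proj -e ray_dist0.
Qed.

Lemma foot_nearest x t : 0 <= t -> d x (alpha (foot x)) <= d x (alpha t).
Proof.
move=> t0; have [_ h] := xgetPex x (ray_nearest x).
by rewrite -nearest_projE; apply: h; exists t => //=; rewrite in_itv/= t0.
Qed.

Hypothesis X_cat0 : cat0_space X.

Lemma foot_le_dist x q : 0 <= q ->
  d (alpha q) (alpha (foot x)) <= d x (alpha q).
Proof.
move=> q0; rewrite leNgt; apply/negP; set p := foot x; set E := d x _.
set l := d (alpha q) _ => El; have E0 : 0 <= E := dist_ge0 _ _.
have p0 : 0 <= p := foot_ge0 x.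
(* Makes [(1 - tau) * l ^+ 2] the mean of [l ^+ 2] and [E ^+ 2], hence above [E ^+ 2]; Stewart at
   the point a fraction [tau] of the way from the foot to [alpha q] bounds it by [E ^+ 2]. *)
pose tau := (l ^+ 2 - E ^+ 2) / (2 * l ^+ 2).
have l0 : 0 < l by lra.
have l20 : 0 < l ^+ 2 by rewrite exprn_gt0.
have El2 : E ^+ 2 < l ^+ 2 by rewrite ltr_pXn2r// ?nnegrE// ltW.
have tl : 2 * tau * l ^+ 2 = l ^+ 2 - E ^+ 2.
  by rewrite /tau; field; rewrite gt_eqF.
have t0 : 0 < tau by rewrite divr_gt0//; lra.
have t1 : tau < 1 by rewrite ltr_pdivrMr; have := sqr_ge0 E; lra.
have lE : `|q - p| = l by rewrite /l ray_dist.
pose r := p + tau * (q - p).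
have r0 : 0 <= r.
  have -> : r = (1 - tau) * p + tau * q by rewrite /r; ring.
  by apply: addr_ge0; apply: mulr_ge0; lra.
have d1 : d (alpha p) (alpha r) = tau * l.
  rewrite ray_dist// distrC.
  have -> : r - p = tau * (q - p) by rewrite /r; ring.
  by rewrite normrM gtr0_norm// lE.
have d2 : d (alpha r) (alpha q) = (1 - tau) * l.
  rewrite ray_dist// distrC.
  have -> : q - r = (1 - tau) * (q - p) by rewrite /r; ring.
  by rewrite normrM gtr0_norm ?subr_gt0// lE.
have d3 : d (alpha p) (alpha q) = l by rewrite dist_sym.
have := stewart X_cat0 x (_ : between (alpha p) (alpha r) (alpha q)).
rewrite /between d1 d2 d3 -/E => /(_ ltac:(lra)).
have := foot_nearest x r0; rewrite -/p.
move: (d x (alpha p)) (d x (alpha r)) (dist_ge0 x (alpha p)) => F H F0 FH.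
have FH2 : F ^+ 2 <= H ^+ 2 by rewrite ler_pXn2r// nnegrE; lra.
move=> h; have {}h : F ^+ 2 + (1 - tau) * l ^+ 2 <= E ^+ 2.
  rewrite -(ler_pM2l (mulr_gt0 t0 l0)).
  have := ler_wpM2l (ltW l0) FH2; lra.
have := sqr_ge0 F; lra.
Qed.

Variables (D : R) (D_ge0 : 0 <= D).
Hypothesis foot_contracting : forall x y,
  d x y < d x (alpha (foot x)) -> d (alpha (foot x)) (alpha (foot y)) < D.

(** Otherwise the point [z] of the segment whose distance to [alpha q] is that of the foot of [x]
    less [D] would be closer to [x] than the ray is. Contraction would keep its foot within [D] of
    that of [x], while [foot_le_dist] puts it too close to [alpha q]. *)
Lemma dist_to_ray_ge x q : 0 <= q ->
  d x (alpha (foot x)) + d (alpha q) (alpha (foot x)) - D <= d x (alpha q).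
Proof.
move=> q0; have D0 := D_ge0; have lip := foot_le_dist x q0.
have fl := foot_nearest x q0.
have [|Dl] := lerP (d (alpha q) (alpha (foot x))) D; first lra.
rewrite leNgt; apply/negP => lt.
have [z [xz zq _]] := @exists_between R X X_cat0 x (alpha q)
  (d x (alpha q) - (d (alpha q) (alpha (foot x)) - D)) ltac:(lra).
have := foot_contracting (x := x) (y := z) ltac:(lra).
have := foot_le_dist z q0; rewrite zq.
have := dist_triangle (alpha q) (alpha (foot z)) (alpha (foot x)).
rewrite (dist_sym (alpha (foot z))); lra.
Qed.

(** [delta] is chosen before the geodesic, so that the lemma applies to points of [beta] as well as
    to chosen segments. *)
Lemma near_ray_point x q : 0 <= q ->
  exists2 delta, 0 <= delta <= d x (alpha q) &
  forall z, d x z = delta -> between x z (alpha q) ->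
    d z (alpha (foot z)) <= 1 + 2 * D /\
    d (alpha (foot x)) (alpha (foot z)) <= D.
Proof.
move=> q0; have D0 := D_ge0; have fl := foot_nearest x q0.
have f0 := dist_ge0 x (alpha (foot x)).
have [f1|f1] := lerP (d x (alpha (foot x))) 1.
  exists 0; first by rewrite lexx (le_trans f0).
  move=> z /dist_eq0 <- _; rewrite distxx; lra.
(* Subtracting 1 gives the strict inequality that contraction requires. *)
exists (d x (alpha (foot x)) - 1); first lra.
move=> z xz; rewrite /between => bz.
have cz := foot_contracting (x := x) (y := z) ltac:(lra).
split; last exact: ltW.
have := dist_to_ray_ge z q0.
have := dist_triangle x (alpha (foot x)) (alpha q).
rewrite (dist_sym (alpha (foot x)) (alpha q)).
have := dist_triangle (alpha q) (alpha (foot z)) (alpha (foot x)).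
rewrite (dist_sym (alpha (foot z))); lra.
Qed.

End Rays.

(** * Limits in complete CAT(0) spaces *)

Section Completeness.
Variables (R : realType) (X : metricType R).
Hypothesis X_complete : complete_space X.
Local Notation d := (@dist R X).

Lemma complete_space_dist (u : nat -> X) :
  (forall e : R, 0 < e -> exists N, forall m n, (N <= m <= n)%N ->
     d (u m) (u n) <= e) ->
  exists l, forall e : R, 0 < e -> exists N, forall n, (N <= n)%N ->
    d (u n) l <= e.
Proof.
move=> uC; have [|l ul] := X_complete (u := u).
  apply: cauchy_exP => e e0.
  have [N hN] := uC (e / 2) ltac:(lra).
  exists (u N); exists N => // n /= Nn; rewrite ballEmdist /=.
  have : d (u N) (u n) <= e / 2 by apply: hN; rewrite leqnn Nn.
  by rewrite /dist => h; apply: le_lt_trans h _; lra.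
exists l => e e0; move/cvg_ballP : ul => /(_ e e0)[N _ hN].
exists N => n Nn; have := hN n Nn; rewrite ballEmdist /= dist_sym.
exact: ltW.
Qed.

Hypothesis X_cat0 : cat0_space X.

(* Choosing in each [A n] a point that almost realises the distance to [o] gives
   a Cauchy sequence, by the CN inequality. *)
Lemma nested_convex_sets_meet (A : nat -> set X) (o : X) (C : R) :
  (forall m n, (m <= n)%N -> A n `<=` A m) ->
  (forall n x y m, A n x -> A n y -> (forall p, 2 * d p m <= d p x + d p y) ->
     A n m) ->
  (forall n, exists2 x, A n x & d o x <= C) ->
  exists z, forall n (e : R), 0 < e -> exists2 x, A n x & d x z <= e.
Proof.
move=> Adecr Amid AC.
pose S n := [set d o x | x in A n].
have S0 n : has_inf (S n).
  split; first by have [x Ax _] := AC n; exists (d o x); exists x.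
  by exists 0 => _ [x _ <-]; exact: dist_ge0.
pose r n := inf (S n).
have rle n x : A n x -> r n <= d o x.
  by move=> Ax; apply: ge_inf; [case: (S0 n)|exists x].
have r0 n : 0 <= r n.
  by apply: lb_le_inf; [case: (S0 n)|move=> _ [x _ <-]; exact: dist_ge0].
have rC n : r n <= C by have [x Ax xC] := AC n; exact: le_trans (rle _ _ Ax) xC.
have C0 : 0 <= C by exact: le_trans (r0 0%N) (rC 0%N).
have rmono m n : (m <= n)%N -> r m <= r n.
  move=> mn; apply: lb_le_inf; first by case: (S0 n).
  by move=> _ [x Ax <-]; apply: rle; exact: Adecr Ax.
have hs : has_sup (range r).
  by split; [exists (r 0%N); exists 0%N|exists C => _ [n _ <-]].
pose rr := sup (range r).
have rrr n : r n <= rr by apply: ub_le_sup; [case: hs|exists n].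
have rrC : rr <= C by apply: ge_sup; [case: hs|move=> _ [n _ <-]].
have /choice[x hx] n : exists x, A n x /\ d o x <= r n + n.+1%:R^-1.
  have [|_ [x Ax <-] h] := @inf_adherent R (S n) n.+1%:R^-1 _ (S0 n).
    by rewrite invr_gt0.
  by exists x; split => //; exact: ltW.
(* The midpoint of [x m] and [x n] lies in [A m], so its distance to [o] is at least [r m]; CN then
   bounds the distance of the two points by a difference of squares, factored here. *)
have key m n : (m <= n)%N ->
    d (x m) (x n) ^+ 2 <= 4 * ((rr - r m + m.+1%:R^-1) * (2 * C + 1)).
  move=> mn; have [c hc] := midpoint_CN X_cat0 (x m) (x n).
  have [Am om] := hx m; have [An on] := hx n.
  have oc : r m <= d o c.
    apply: rle; apply: (Amid _ (x m) (x n)) => //; first exact: Adecr An.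
    by move=> p; exact: CN_midpoint_le (hc p).
  have eps : n.+1%:R^-1 <= m.+1%:R^-1 :> R.
    by rewrite lef_pV2 ?posrE// ler_nat ltnS.
  have e0 : 0 < m.+1%:R^-1 :> R by rewrite invr_gt0.
  have e1 : m.+1%:R^-1 <= 1 :> R by rewrite invf_le1// ler1n.
  have := hc o; have := rrr n; have := rrr m; have := rC m; have := r0 m.
  have := dist_ge0 o (x m); have := dist_ge0 o (x n).
  move: om on oc eps e0 e1 rrC C0; move: (m.+1%:R^-1) (n.+1%:R^-1).
  move: (d o (x m)) (d o (x n)) (d o c) (d (x m) (x n)) (r m) (r n).
  move=> a b c' l s t e f h1 h2 h3 h4 h5 h6 h7 h8 h9 h10 h11 h12 h13 h14 h15.
  have : a ^+ 2 <= (rr + e) ^+ 2 by rewrite ler_pXn2r// ?nnegrE; lra.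
  have : b ^+ 2 <= (rr + e) ^+ 2 by rewrite ler_pXn2r// ?nnegrE; lra.
  have : s ^+ 2 <= c' ^+ 2 by rewrite ler_pXn2r// ?nnegrE; lra.
  have : 0 <= (rr - s + e) * (2 * C + 1 - (rr + e + s)) by apply: mulr_ge0; lra.
  lra.
have [|z hz] := complete_space_dist (u := x).
  move=> e e0; have K0 : 0 < 4 * (2 * C + 1) by lra.
  pose dl := e ^+ 2 / (4 * (2 * C + 1)) / 2.
  have dl0 : 0 < dl by rewrite !divr_gt0// exprn_gt0.
  have [_ [N1 _ <-] hN1] := sup_adherent dl0 hs.
  have [N2 _ hN2] := near_infty_natSinv_lt (PosNum dl0).
  exists (maxn N1 N2) => m n /andP[Nm mn].
  have := key m n mn.
  have h2 : m.+1%:R^-1 < dl := hN2 m (leq_trans (leq_maxr _ _) Nm).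
  have := rmono _ _ (leq_trans (leq_maxl _ _) Nm); rewrite -/rr in hN1 *.
  move=> h1 h; rewrite -(ler_pXn2r (n := 2))// ?nnegrE ?dist_ge0 ?(ltW e0)//.
  apply: le_trans h _.
  have -> : e ^+ 2 = 4 * (2 * dl * (2 * C + 1)) by rewrite /dl; field; lra.
  rewrite ler_pM2l// ler_pM2r; last by lra.
  by move: h2; move: (m.+1%:R^-1) => f h2; lra.
exists z => n e e0; have [N hN] := hz e e0.
exists (x (maxn n N)); last by apply: hN; exact: leq_maxr.
by have [Ax _] := hx (maxn n N); exact: Adecr (leq_maxl n N) _ Ax.
Qed.

End Completeness.

Lemma nat_ge_real (R : realType) (a : R) :
  exists N : nat, forall n, (N <= n)%N -> a <= n%:R.
Proof.
have [N hN] : exists N : nat, a <= N%:R.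
  exists (Num.truncn `|a|).+1; apply: le_trans (ler_norm a) (ltW _).
  exact: truncnS_gt.
by exists N => n Nn; apply: le_trans hN _; rewrite ler_nat.
Qed.

(** * The ray from a given point asymptotic to a given ray *)

Section AsymptoticRay.
Variables (R : realType) (X : metricType R).
Local Notation d := (@dist R X).

(** [rho] is the pointwise limit of the segments from [z] to [alpha n]; the last clause keeps this
    approximation for later use. *)
Lemma asymptotic_ray_exists (X_complete : complete_space X)
    (X_cat0 : cat0_space X) (alpha : R -> X) (alpha_ray : geodesic_ray alpha)
    (z : X) :
  exists rho : R -> X, [/\ geodesic_ray rho, rho 0 = z, asymptotic alpha rho &
    forall s e : R, 0 <= s -> 0 < e -> exists N, forall n : nat, (N <= n)%N ->
      exists y, [/\ d z y = s, between z y (alpha n%:R) & d y (rho s) <= e]].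
Proof.
pose C := d z (alpha 0); have C0 : 0 <= C := dist_ge0 _ _.
pose l (n : nat) := d z (alpha n%:R).
have lu n : l n <= n%:R + C.
  have := dist_triangle z (alpha 0) (alpha n%:R).
  by rewrite (ray_dist0 alpha_ray)// -/C -/(l n); lra.
have ll n : n%:R - C <= l n.
  have := dist_triangle (alpha 0) z (alpha n%:R).
  by rewrite (ray_dist0 alpha_ray)// (dist_sym _ z) -/C -/(l n); lra.
have /choice[sg hsg] n := X_cat0.1 z (alpha n%:R).
have sgP n (s : R) : 0 <= s <= l n ->
    [/\ d z (sg n s) = s, d (sg n s) (alpha n%:R) = l n - s &
        between z (sg n s) (alpha n%:R)].
  exact: geodesic_segment_between.
have sg_dist n (s t : R) : 0 <= s <= l n -> 0 <= t <= l n ->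
    d (sg n s) (sg n t) = `|s - t|.
  by have [_ _] := geodesic_segment_dist (hsg n); exact.
(* The difference of [l n] and [l m] is [n - m] up to [2 * C], so the comparison angle at [z] tends
   to 0. *)
have key (s : R) m n : 0 <= s -> (m <= n)%N -> s + 2 * C + 1 <= m%:R ->
    (m%:R - C) * d (sg m s) (sg n s) ^+ 2 <= 8 * C * s ^+ 2.
  move=> s0 mn hm; have hmn : m%:R <= n%:R :> R by rewrite ler_nat.
  have lm := ll m; have ln := ll n.
  have [zm _ bm] := sgP m s ltac:(lra); have [zn _ bn] := sgP n s ltac:(lra).
  have := two_sided_comparison X_cat0 bm bn.
  rewrite zm zn (ray_dist_le alpha_ray)// -/(l m) -/(l n).
  have := dist_triangle z (alpha m%:R) (alpha n%:R).
  rewrite (ray_dist_le alpha_ray)// -/(l m) -/(l n).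
  have := dist_triangle z (alpha n%:R) (alpha m%:R).
  rewrite (dist_sym (alpha n%:R)) (ray_dist_le alpha_ray)// -/(l m) -/(l n).
  have := lu m; have := lu n; have := sqr_ge0 (d (sg m s) (sg n s)).
  move: lm ln hm hmn; move: (m%:R : R) (n%:R : R) (l m) (l n) (_ ^+ 2).
  move=> M N a b E h1 h2 h3 h4 E0 h5 h6 h7' h7 h8.
  have : (N - M - (b - a)) * (N - M + (b - a)) <= 8 * C * b.
    apply: (@le_trans _ _ (2 * C * (2 * (N - M)))); last first.
      have : 0 <= C * (2 * b - (N - M)) by apply: mulr_ge0; lra.
      lra.
    apply: (@le_trans _ _ (2 * C * (N - M + (b - a)))).
      by apply: ler_wpM2r; lra.
    by apply: ler_wpM2l; lra.
  move=> h9; have b0 : 0 < b by lra.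
  have h10 : a * E <= 8 * C * s ^+ 2.
    rewrite -(ler_pM2l b0).
    have := ler_wpM2l (sqr_ge0 s) h9; move: h8; lra.
  by apply: le_trans h10; apply: ler_wpM2r; lra.
(* Choice needs a value at every real; for negative [s] it is the default [z]. *)
have /choice[rho hrho] (s : R) : exists y, 0 <= s -> forall e : R, 0 < e ->
    exists N, forall n, (N <= n)%N -> d (sg n s) y <= e.
  have [s0|] := lerP 0 s; last by exists z.
  have [|y hy] := complete_space_dist X_complete (u := sg ^~ s);
    last by exists y.
  move=> e e0.
  have [N hN] := nat_ge_real (s + 2 * C + 1 + 8 * C * s ^+ 2 / e ^+ 2).
  exists N => m n /andP[Nm mn]; have := hN m Nm.
  have e20 : 0 < e ^+ 2 by rewrite exprn_gt0.
  have q0 : 0 <= 8 * C * s ^+ 2 / e ^+ 2.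
    by rewrite divr_ge0 ?mulr_ge0 ?sqr_ge0//; lra.
  move=> hm; have := key s m n s0 mn ltac:(lra) => h.
  rewrite -(ler_pXn2r (n := 2))// ?nnegrE ?dist_ge0 ?(ltW e0)//.
  have Mp : 0 < m%:R - C by lra.
  rewrite -(ler_pM2l Mp); apply: le_trans h _.
  by rewrite -ler_pdivrMr//; lra.
have approx (s e : R) : 0 <= s -> 0 < e -> exists N, forall n, (N <= n)%N ->
    s <= l n /\ d (sg n s) (rho s) <= e.
  move=> s0 e0; have [N1 h1] := hrho s s0 e e0.
  have [N2 h2] := nat_ge_real (s + C).
  exists (maxn N1 N2) => n; rewrite geq_max => /andP[n1 n2]; split.
    by have := h2 n n2; have := ll n; lra.
  exact: h1.
have eps_eq (a b : R) : (forall e, 0 < e -> `|a - b| <= 2 * e) -> a = b.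
  move=> h; apply/eqP; rewrite -subr_eq0 -normr_le0; apply/ler_addgt0Pl => e e0.
  by have := h (e / 2) ltac:(lra); rewrite addr0 mulrC divfK.
exists rho; split.
- move=> s t; rewrite /= !in_itv/= !andbT => s0 t0.
  change (d (rho s) (rho t) = `|s - t|).
  apply: eps_eq => e e0.
  have [N1 h1] := approx s e s0 e0; have [N2 h2] := approx t e t0 e0.
  have [sl se] := h1 _ (leq_maxl N1 N2); have [tl te] := h2 _ (leq_maxr N1 N2).
  rewrite -(sg_dist (maxn N1 N2) s t ltac:(lra) ltac:(lra)).
  move: se te; move: (sg _ s) (sg _ t) => x y se te; rewrite ler_norml.
  have := dist_triangle x (rho s) y; have := dist_triangle (rho s) (rho t) y.
  have := dist_triangle (rho s) x (rho t); have := dist_triangle x y (rho t).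
  rewrite (dist_sym (rho s) x) (dist_sym (rho t) y); lra.
- apply: dist_eq0; apply: eps_eq => e e0.
  have [N h] := approx 0 e (lexx _) e0; have [_ he] := h _ (leqnn N).
  have [c0 _ _] := hsg N; move: he; rewrite c0 subr0 ger0_norm ?dist_ge0//.
  by rewrite dist_sym; lra.
- exists (2 * C + 1) => t t0; change (d (alpha t) (rho t) <= 2 * C + 1).
  have [N1 h1] := approx t 1 t0 ltr01.
  have [N2 h2] := nat_ge_real (t + C + 1).
  set n := maxn N1 N2; have [tl te] := h1 n (leq_maxl _ _).
  have hn := h2 n (leq_maxr _ _).
  have := ll n; have := lu n; move=> hu hl.
  pose n' : R := n%:R; have n0 : 0 < n' by rewrite /n'; lra.
  (* The same proportion of the segment as [t] is of [n]: [thales] with apex [alpha n] costs [C],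
     correcting [t'] to [t] costs [C], and passing to [rho] costs 1. *)
  pose t' := t * (l n / n').
  have q0 : 0 <= l n / n' by rewrite divr_ge0 ?dist_ge0// ltW.
  have t'0 : 0 <= t' by rewrite mulr_ge0.
  have tn : t / n' <= 1 by rewrite ler_pdivrMr// mul1r /n'; lra.
  have t'E : t' = (t / n') * l n by rewrite /t'; ring.
  have t'l : t' <= l n.
    by rewrite t'E -[leRHS]mul1r ler_wpM2r// dist_ge0.
  have [e1 e2 b] := sgP n t' ltac:(lra).
  have hx : d (alpha t) (sg n t') <= C.
    have := thales X_cat0 (between_sym (ray_between alpha_ray (lexx 0) t0 _))
      (between_sym b).
    rewrite -/n' => /(_ ltac:(rewrite /n'; lra)).
    rewrite !(dist_sym (alpha n')) (ray_dist0 alpha_ray) ?(ltW n0)//.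
    rewrite (ray_dist_le alpha_ray)//; last by rewrite /n'; lra.
    rewrite e2 -/(l n) (dist_sym (alpha 0)) -/C => /(_ _)/wrap[|h].
      by rewrite /t'; field; lra.
    rewrite -(ler_pM2l n0); apply: le_trans h _.
    have : 0 <= t * C by rewrite mulr_ge0.
    lra.
  have hy : d (sg n t') (sg n t) <= C.
    rewrite (sg_dist n t' t ltac:(lra) ltac:(lra)).
    have -> : t' - t = (t / n') * (l n - n') by rewrite /t'; field; lra.
    rewrite normrM ger0_norm; last by rewrite divr_ge0// ltW.
    apply: (@le_trans _ _ (1 * `|l n - n'|)); first exact: ler_wpM2r.
    by rewrite mul1r ler_norml /n'; lra.
  have := dist_triangle (alpha t) (sg n t') (rho t).
  have := dist_triangle (sg n t') (sg n t) (rho t); lra.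
- move=> s e s0 e0; have [N h] := approx s e s0 e0.
  exists N => n Nn; have [sl se] := h n Nn; exists (sg n s).
  by have [? _ ?] := sgP n s ltac:(lra).
Qed.

End AsymptoticRay.

(** * Two rays with the same origin *)

Section Boundary.
Variables (R : realType) (X : metricType R).

Lemma asymptotic_sym (a b : R -> X) : asymptotic a b -> asymptotic b a.
Proof. by move=> [K h]; exists K => t /h; rewrite metric_sym. Qed.

Lemma asymptotic_trans (a b c : R -> X) :
  asymptotic a b -> asymptotic b c -> asymptotic a c.
Proof.
move=> [K h] [K' h']; exists (K + K') => t t0.
exact: le_trans (metric_triangle _ (b t) _) (lerD (h _ t0) (h' _ t0)).
Qed.

Lemma boundary_point_eq (a b : R -> X) :
  asymptotic a b -> boundary_point a = boundary_point b.
Proof.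
move=> ab; apply/seteqP; split => c [cr ac]; split => //.
  exact: asymptotic_trans (asymptotic_sym ab) ac.
exact: asymptotic_trans ab ac.
Qed.

End Boundary.

Section TwoRays.
Variables (R : realType) (X : metricType R).
Local Notation d := (@dist R X).
Variables (alpha beta : R -> X).
Hypotheses (alpha_ray : geodesic_ray alpha) (beta_ray : geodesic_ray beta).
Hypothesis same_origin : alpha 0 = beta 0.
Hypotheses (X_complete : complete_space X) (X_cat0 : cat0_space X).
Local Notation foot := (foot alpha).

(** * Bounded projection, and chords passing near the origin *)

Section ContractingRay.
Variable D : R.
Hypothesis D_ge0 : 0 <= D.
Hypothesis foot_contracting : forall x y,
  d x y < d x (alpha (foot x)) -> d (alpha (foot x)) (alpha (foot y)) < D.

Lemma foot_bounded : (exists t : R, 0 <= t /\ alpha t <> beta t) ->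
  exists P : R, forall t : R, 0 <= t -> foot (beta t) <= P.
Proof.
move=> [u [u0 ne]]; have D0 := D_ge0.
have e0 : 0 < d (alpha u) (beta u).
  by rewrite lt_neqAle dist_ge0 andbT; apply/eqP => /esym /dist_eq0.
(* [D] moves from the foot of [beta t] to that of [beta s]; the other terms bound [s], by [u] or by
   divergence past [u]. *)
exists (D + u + u * (2 + 4 * D) / d (alpha u) (beta u)) => t t0.
have [delta + h] := near_ray_point alpha_ray X_cat0 D_ge0 foot_contracting
  (beta t) (lexx 0).
have bd (s : R) : 0 <= s -> d (beta s) (alpha 0) = s.
  by move=> s0; rewrite same_origin dist_sym ray_dist0.
rewrite bd// => /andP[delta0 deltat].
pose s := t - delta; have s0 : 0 <= s by rewrite /s; lra.
have st : s <= t by rewrite /s; lra.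
have dE : d (beta t) (beta s) = delta.
  by rewrite dist_sym ray_dist_le// /s; lra.
have [|near ff] := h (beta s) dE.
  by rewrite /between dE !bd// /s; lra.
have fs : foot (beta s) <= s.
  have := foot_le_dist alpha_ray X_cat0 (beta s) (lexx 0).
  by rewrite bd// (ray_dist0 alpha_ray)// foot_ge0.
have ft : foot (beta t) <= foot (beta s) + D.
  have := dist_triangle (alpha 0) (alpha (foot (beta s))) (alpha (foot (beta t))).
  rewrite !(ray_dist0 alpha_ray) ?foot_ge0//.
  by rewrite (dist_sym (alpha (foot (beta s)))); lra.
(* [1 + 2 * D] bounds the distance from [beta s] to its foot, hence also the gap between [s] and the
   foot's parameter. *)
have close : d (alpha s) (beta s) <= 2 + 4 * D.
  have := dist_triangle (beta s) (alpha (foot (beta s))) (alpha 0).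
  rewrite bd// (dist_sym _ (alpha 0)) (ray_dist0 alpha_ray) ?foot_ge0//.
  have := dist_triangle (beta s) (alpha (foot (beta s))) (alpha s).
  rewrite (ray_dist_le alpha_ray) ?foot_ge0//.
  by rewrite (dist_sym (beta s) (alpha s)); lra.
have [su|us] := lerP s u.
  have : 0 <= u * (2 + 4 * D) / d (alpha u) (beta u).
    by rewrite divr_ge0 ?mulr_ge0 ?dist_ge0//; lra.
  lra.
have b1 := ray_between alpha_ray (lexx 0) u0 (ltW us).
have b2 := ray_between beta_ray (lexx 0) u0 (ltW us).
rewrite -same_origin in b2.
have := thales X_cat0 b1 b2.
rewrite !(ray_dist0 alpha_ray)// !(dist_sym (alpha 0)) !bd// => /(_ erefl) le.
suff : s <= u * (2 + 4 * D) / d (alpha u) (beta u) by lra.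
rewrite ler_pdivlMr//; apply: le_trans le _.
exact: ler_wpM2l.
Qed.

Variable P : R.
Hypothesis foot_le : forall t : R, 0 <= t -> foot (beta t) <= P.

(** The foot of [z] has parameter at most [P + D], and [z] is within [1 + 2 * D] of it. *)
Lemma chord_near_origin (s t : R) : 0 <= s -> 0 <= t ->
  exists2 z, between (beta t) z (alpha s) & d (alpha 0) z <= 1 + 3 * D + P.
Proof.
move=> s0 t0; have D0 := D_ge0.
have [delta hd h] := near_ray_point alpha_ray X_cat0 D_ge0 foot_contracting
  (beta t) s0.
have [z [dz _ bz]] := exists_between X_cat0 hd.
exists z => //; have [hz hf] := h z dz bz.
have := dist_triangle (alpha 0) (alpha (foot z)) z.
have := dist_triangle (alpha 0) (alpha (foot (beta t))) (alpha (foot z)).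
rewrite !(ray_dist0 alpha_ray) ?foot_ge0// (dist_sym (alpha (foot z)) z).
have := foot_le t0; lra.
Qed.

(** In [dist_to_ray_ge], a foot parameter at most [P] costs [P] for each of the two distances. *)
Lemma chord_length_ge (s t : R) : 0 <= s -> 0 <= t ->
  s + t - 2 * P - D <= d (alpha s) (beta t).
Proof.
move=> s0 t0; have D0 := D_ge0; have hP := foot_le t0.
have bt : d (alpha 0) (beta t) = t by rewrite same_origin ray_dist0.
have := dist_to_ray_ge alpha_ray X_cat0 D_ge0 foot_contracting (beta t) s0.
have := dist_triangle (alpha 0) (alpha (foot (beta t))) (alpha s).
have := dist_triangle (alpha 0) (alpha (foot (beta t))) (beta t).
rewrite bt !(ray_dist0 alpha_ray) ?foot_ge0// !(dist_sym (alpha s)).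
by rewrite (dist_sym (alpha (foot (beta t))) (beta t)); lra.
Qed.

End ContractingRay.

(* The limit of [excess n] is the sum of the Busemann functions of the two
   rays, whose minimum set is the union of the lines joining their endpoints. *)
Definition excess (n : nat) (x : X) : R :=
  d x (alpha n%:R) + d x (beta n%:R) - 2 * n%:R.

Lemma excess_anti m n x : (m <= n)%N -> excess n x <= excess m x.
Proof.
move=> mn; have mn' : m%:R <= n%:R :> R by rewrite ler_nat.
have := dist_triangle x (alpha m%:R) (alpha n%:R).
have := dist_triangle x (beta m%:R) (beta n%:R).
by rewrite !ray_dist_le// /excess; lra.
Qed.

(** The hypotheses make the path from [alpha n] through [z] to [beta n] almost as short as the chord
    for large [n], so no shortcut between the two limit rays from [z] is possible. *)
Lemma line_through_minimum (z : X) (L : R) :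
  (forall n : nat, L <= d (alpha n%:R) (beta n%:R) - 2 * n%:R) ->
  (forall e : R, 0 < e -> exists n, excess n z <= L + e) ->
  exists gamma : R -> X, [/\ geodesic_line gamma,
    asymptotic gamma alpha & asymptotic (fun t => gamma (- t)) beta].
Proof.
move=> hL hz.
have [p [p_ray p0 ap hp]] := asymptotic_ray_exists X_complete X_cat0 alpha_ray z.
have [q [q_ray q0 bq hq]] := asymptotic_ray_exists X_complete X_cat0 beta_ray z.
have opp (s t : R) : 0 <= s -> 0 <= t -> d (p s) (q t) = s + t.
  move=> s0 t0; apply/eqP; rewrite eq_le; apply/andP; split.
    have := dist_triangle (p s) z (q t).
    have -> : d (p s) z = s by rewrite -p0 dist_sym ray_dist0.
    by have -> : d z (q t) = t by rewrite -q0 ray_dist0.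
  apply/ler_addgt0Pr => e e0; have e30 : 0 < e / 3 by lra.
  have [N1 h1] := hp s (e / 3) s0 e30; have [N2 h2] := hq t (e / 3) t0 e30.
  have [N3 h3] := hz (e / 3) e30.
  pose n := maxn N1 (maxn N2 N3).
  have [y1 [dy1 by1 ey1]] := h1 n (leq_maxl _ _).
  have [y2 [dy2 by2 ey2]] := h2 n (leq_trans (leq_maxl _ _) (leq_maxr _ _)).
  have := excess_anti z (leq_trans (leq_maxr _ _) (leq_maxr _ _) : (N3 <= n)%N).
  have := hL n; rewrite /excess.
  have := dist_triangle (alpha n%:R) y1 (beta n%:R).
  have := dist_triangle y1 y2 (beta n%:R).
  have := dist_triangle y1 (p s) y2; have := dist_triangle (p s) (q t) y2.
  rewrite (dist_sym (q t)) (dist_sym (alpha _) y1).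
  move: by1 by2; rewrite /between dy1 dy2; rewrite /excess in h3; lra.
pose gamma t := if 0 <= t then p t else q (- t).
exists gamma; split.
- move=> s t _ _; change (d (gamma s) (gamma t) = `|s - t|).
  rewrite /gamma; case: (lerP 0 s) => hs; case: (lerP 0 t) => ht.
  + exact: ray_dist.
  + by rewrite opp//; [rewrite ger0_norm//|]; lra.
  + by rewrite dist_sym opp//; [rewrite distrC ger0_norm//|]; lra.
  + rewrite ray_dist//; [|lra..].
    by rewrite (_ : - s - - t = - (s - t)) ?normrN//; ring.
- have [K hK] := asymptotic_sym ap; exists K => t t0.
  by rewrite /gamma t0; exact: hK.
- have [K hK] := asymptotic_sym bq; exists K => t t0.
  (* The first branch occurs only at [t = 0], where both rays are at [z]. *)
  rewrite /gamma; case: ifPn => [h|_]; last by rewrite opprK; exact: hK.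
  have -> : t = 0 by lra.
  by rewrite oppr0 p0 -q0; exact: hK.
Qed.

End TwoRays.

Theorem proposition3p6 (R : realType) (X : metricType R)
    (X_complete : complete_space X) (X_cat0 : cat0_space X)
    (x0 : X) (alpha beta : R -> X)
    (alpha_ray : geodesic_ray alpha) (beta_ray : geodesic_ray beta)
    (alpha0 : alpha 0 = x0) (beta0 : beta 0 = x0)
    (alpha_neq_beta : exists t : R, 0 <= t /\ alpha t <> beta t)
    (alpha_contracting : contracting (ray_image alpha)) :
  bounded_subset (nearest_proj (ray_image alpha) @` ray_image beta) /\
  exists gamma : R -> X,
    [/\ geodesic_line gamma,
        boundary_point gamma = boundary_point alpha &
        boundary_point (fun t => gamma (- t)) = boundary_point beta].
Proof.
have ab0 : alpha 0 = beta 0 by rewrite alpha0.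
have [D' hD'] := alpha_contracting; pose D := Num.max D' 0.
have D0 : 0 <= D by rewrite le_max lexx orbT.
have hD x y : dist x y < dist x (alpha (foot alpha x)) ->
    dist (alpha (foot alpha x)) (alpha (foot alpha y)) < D.
  rewrite -!nearest_projE// => /hD' h; apply: lt_le_trans h _.
  by rewrite le_max lexx.
have [P hP] := foot_bounded alpha_ray beta_ray ab0 X_cat0 D0 hD alpha_neq_beta.
split.
  exists (P + P) => _ _ [_ [s /=/[!in_itv]/= /andP[s0 _] <-] <-]
    [_ [t /=/[!in_itv]/= /andP[t0 _] <-] <-].
  rewrite !nearest_projE//.
  apply: le_trans (dist_triangle _ (alpha 0) _) _.
  by rewrite dist_sym !(ray_dist0 alpha_ray) ?foot_ge0//; apply: lerD; exact: hP.
(* The minimum of [excess n], attained on the segment from [alpha n] to [beta n]. *)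
pose chord n := dist (alpha n%:R) (beta n%:R) - 2 * n%:R.
have chord_inf : has_inf (range chord).
  split; first by exists (chord 0%N); exists 0%N.
  exists (- 2 * P - D) => _ [n _ <-].
  have := chord_length_ge alpha_ray beta_ray ab0 X_cat0 D0 hD hP
    (ler0n R n) (ler0n R n).
  by rewrite /chord; lra.
pose L := inf (range chord).
have hL n : L <= chord n by apply: ge_inf; [case: chord_inf|exists n].
(* The existential over [k] stands for the limit of the excess; since the excess decreases in [k],
   two witnesses can be replaced by their maximum. *)
pose A n := [set x | exists k, excess alpha beta k x <= L + n.+1%:R^-1].
have [|||z hz] := nested_convex_sets_meet X_complete X_cat0 (A := A)
    (o := alpha 0) (C := 1 + 3 * D + P).
- move=> m n mn x [k hk]; exists k; apply: le_trans hk _.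
  by rewrite lerD2l lef_pV2 ?posrE// ler_nat ltnS.
- move=> n x y m [i hi] [j hj] hm; exists (maxn i j).
  have := excess_anti alpha_ray beta_ray x (leq_maxl i j).
  have := excess_anti alpha_ray beta_ray y (leq_maxr i j).
  move: hi hj; move: (maxn i j) => k; rewrite /excess.
  have := hm (alpha k%:R); have := hm (beta k%:R).
  rewrite !(dist_sym (alpha k%:R)) !(dist_sym (beta k%:R)).
  by move: (n.+1%:R^-1) => f; lra.
- move=> n; have [|_ [k _ <-] hk] := inf_adherent (eps := n.+1%:R^-1) _ chord_inf.
    by rewrite invr_gt0.
  have [z bz hz] := chord_near_origin alpha_ray X_cat0 D0 hD hP
    (ler0n R k) (ler0n R k).
  exists z => //; exists k; apply: le_trans (ltW hk).
  move: bz; rewrite /between /excess /chord (dist_sym (alpha _) (beta _)).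
  by rewrite (dist_sym (beta _) z); lra.
have [|gamma [gl ga gb]] := line_through_minimum alpha_ray beta_ray X_complete
  X_cat0 (z := z) hL.
  (* One quarter pays for the slack of [A N], two for moving from [x] to [z], as the excess is
     2-Lipschitz. *)
  move=> e e0; have e40 : 0 < e / 4 by lra.
  have [N _ hN] := near_infty_natSinv_lt (PosNum e40).
  have Ne : N.+1%:R^-1 < e / 4 := hN N (leqnn N).
  have [x [k hk] xz] := hz N _ e40; exists k.
  have := dist_triangle z x (alpha k%:R); have := dist_triangle z x (beta k%:R).
  rewrite (dist_sym z x); move: hk Ne; rewrite /excess.
  by move: (N.+1%:R^-1) => f; lra.
by exists gamma; split => //; exact: boundary_point_eq.
Qed.
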